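(* Let $\Omega\subset\mathbb R$ be a (Lebesgue measurable) set satisfying, for some $\beta>1$, $$\lim_{\delta\to0}\frac{m([x-\delta,x+\delta]\cap\Omega^c)}{\delta^\beta}=0\qquad\forall x\in\Omega .$$ Then for any bounded (measurable) function $g:\mathbb R\to\mathbb C$ which is $\Omega$-Whitney differentiable at $t\in\Omega$, we have $$\lim_{\eta\uparrow1}(M^{\eta,\Omega}g)(t)=g'_\Omega(t).$$ Moreover, for any $\zeta\in(0,1)$ and any bounded (measurable) $g:\mathbb R\to\mathbb R$ which is $\Omega$-Whitney $\zeta$-differentiable at $t\in\Omega$, we have $$\lim_{\eta\uparrow\zeta}\Bigl(\frac{\Gamma(1-\eta)}{\zeta\cdot\Gamma(\zeta-\eta)}(M^{\eta,\Omega}g)(t)\Bigr)=g^\zeta_\Omega(t).$$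
   Context: $m$ is Lebesgue measure and $\Omega^c=\mathbb R\setminus\Omega$. The Whitney--Marchaud derivative of order $\eta\in(0,1)$ of $g$ on $\Omega$ is $$(M^{\eta,\Omega}g)(x)=\frac{\eta}{2\Gamma(1-\eta)}\int_{\Omega-x}\frac{g(x+\tau)-g(x)}{|\tau|^{1+\eta}}\,\mathrm{sgn}(\tau)\,d\tau,\qquad \Omega-x=\{\tau: x+\tau\in\Omega\}.$$ $g$ is $\Omega$-Whitney differentiable at $t\in\Omega$ if there is $g'_\Omega(t)\in\mathbb C$ with $\lim_{\delta\to0,\,t+\delta\in\Omega}\frac{g(t+\delta)-g(t)}{\delta}=g'_\Omega(t)$. For $\zeta\in(0,1)$, $g$ is $\Omega$-Whitney $\zeta$-differentiable at $t\in\Omega$ if there is $g^\zeta_\Omega(t)\in\mathbb C$ with $\lim_{\delta\to0,\,t+\delta\in\Omega}\frac{g(t+\delta)-g(t)}{\mathrm{sgn}(\delta)|\delta|^\zeta}=g^\zeta_\Omega(t)$. *)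

(* Defs.v *)
From HB Require Import structures.
From mathcomp Require Import all_boot all_order all_algebra complex.
From mathcomp Require Import all_classical all_reals all_analysis.

Set Implicit Arguments.
Unset Strict Implicit.
Unset Printing Implicit Defensive.

Import Order.TTheory GRing.Theory Num.Theory.
Import numFieldNormedType.Exports.

Local Open Scope classical_set_scope.
Local Open Scope ring_scope.
Local Open Scope complex_scope.

(* The norm topology of C, copied from the regular module R[i]^o: the generic
   numeric-field instances do not apply to the concrete carrier R[i]. *)
HB.instance Definition _ (R : rcfType) := NormedModule.copy R[i] R[i]^o.

(* [R] with its Lebesgue (not only Borel) measurable sets: the carrier of
   [completed_lebesgue_measure]. *)
Notation lebesgueTypeR R :=
  (caratheodory_type (R := R) (T := ocitv_type R) (wlength idfun)^*%mu).

Section defs.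
Context {R : realType}.
Implicit Types (Omega D : set R) (g f : R -> R[i]).

Definition lebesgue_measurable (A : set R) : Prop :=
  measurable (A : set (lebesgueTypeR R)).

Definition lebesgue_measurable_fun (h : R -> R) : Prop :=
  measurable_fun setT (h : lebesgueTypeR R -> R).

Definition lebesgue_measurable_cfun g : Prop :=
  lebesgue_measurable_fun (@complex.Re R \o g) /\ lebesgue_measurable_fun (@complex.Im R \o g).

Definition cintegral D f : R[i] :=
  (\int[completed_lebesgue_measure]_(u in D) complex.Re (f u)) +i*
  (\int[completed_lebesgue_measure]_(u in D) complex.Im (f u)).

(* Only meaningful for [0 < s]. *)
Definition Gamma (s : R) : R :=
  \int[lebesgue_measure]_(u in `]0, +oo[) (u `^ (s - 1) * expR (- u)).

Definition whitney_marchaud (eta : R) Omega g (x : R) : R[i] :=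
  (eta / (2 * Gamma (1 - eta)))%:C *
  cintegral [set tau | Omega (x + tau)]
    (fun tau => (g (x + tau) - g x) / (`|tau| `^ (1 + eta))%:C
                * (Num.sg tau)%:C).

Definition is_whitney_derive Omega g (t : R) (l : R[i]) : Prop :=
  (g (t + delta) - g t) / delta%:C
    @[delta --> within [set delta | Omega (t + delta)] 0^'] --> l.

Definition is_whitney_zeta_derive (zeta : R) Omega g (t : R) (l : R[i]) : Prop :=
  (g (t + delta) - g t) / (Num.sg delta * `|delta| `^ zeta)%:C
    @[delta --> within [set delta | Omega (t + delta)] 0^'] --> l.

(* [delta] tends to 0 from the right: [delta `^ beta] is a real power and
   [x - delta, x + delta] must be nonempty. *)
Definition complement_thin (beta : R) Omega (x : R) : Prop :=
  fine (completed_lebesgue_measure (`[x - delta, x + delta] `&` ~` Omega))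
    / delta `^ beta @[delta --> 0^'+] --> (0 : R).

End defs.

(* Main.v *)
From HB Require Import structures.
Require Import Defs.
From mathcomp Require Import all_boot all_order all_algebra complex.
From mathcomp Require Import all_classical all_reals all_analysis.
From mathcomp Require Import measurable_realfun ring lra.
Import Order.TTheory GRing.Theory Num.Theory.
Import numFieldNormedType.Exports.
Local Open Scope classical_set_scope.
Local Open Scope ring_scope.
Local Open Scope complex_scope.

(* Write eta = zeta - s with s -> 0+ (zeta = 1 in the first part) and
   E = Omega - t. Since s * Gamma s -> 1, it suffices that s times the integral
   over E of (g (t + tau) - g t) sgn(tau) / |tau|^(1 + eta) tends to twice the
   derivative a. Near 0 the integrand is close to a * |tau|^(s - 1), and
   s * |tau|^(s - 1) has integral 2 d^s -> 2 over |tau| <= d, hence is an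
   approximate identity. The rest stays bounded before multiplication by s: for
   |tau| > d because g is bounded, and off E because beta > 1 makes 1 / |tau|
   integrable over the part of the complement of E near 0. Real and imaginary
   parts are treated separately. *)

(** * Translations and even integrands for the completed Lebesgue measure *)

Section completed_lebesgue.
Context {R : realType}.
Implicit Types (A D : set R) (t : R).
Local Notation lambda := (@lebesgue_measure R).
Local Notation mu := (@completed_lebesgue_measure R).

Lemma preimage_addr_itvoc t (a b : R) :
  +%R t @^-1` `]a, b]%classic = `](a - t), (b - t)]%classic.
Proof.
by apply/seteqP; split=> x /=; rewrite !in_itv/= ltrBlDl lerBrDl.
Qed.

(** The measure is an infimum over countable covers by half-open intervals, and translating a cover
    preserves all lengths. This gives one inequality for every shift; shifting back by [- t] gives
    the other. *)
Lemma completed_lebesgue_measure_addr t A : mu (+%R t @^-1` A) = mu A.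
Proof.
have le_mu u B : (mu (+%R u @^-1` B) <= mu B)%E.
  apply: le_ereal_inf_tmp => _ [C [mC BC] <-].
  apply: ereal_inf_lbound; exists (fun k => +%R u @^-1` C k).
    split=> [k|x /= /BC[k _ Ck]]; last by exists k.
    have [[a b] _ <-] := mC k; rewrite preimage_addr_itvoc.
    by exists (a - u, b - u).
  apply: eq_eseriesr => k _; have [[a b] _ <-] := mC k.
  rewrite preimage_addr_itvoc.
  transitivity (wlength idfun `](a - u), (b - u)]); first by [].
  transitivity (wlength idfun `]a, b]); last by [].
  rewrite !wlength_itv/= !lte_fin ltrBlDr subrK.
  by case: ifP => // _; rewrite -!EFinB opprB addrA subrK.
apply/eqP; rewrite eq_le le_mu/=.
apply: le_trans (le_mu (- t) _); apply: le_outer_measure => x /=.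
by rewrite addrA subrr add0r.
Qed.

(** Measurability is Carathéodory's criterion: by translation invariance, splitting a test set [X]
    along the translate amounts to splitting [Y] along [A]. *)
Lemma lebesgue_measurable_addr t A :
  lebesgue_measurable A -> lebesgue_measurable (+%R t @^-1` A).
Proof.
move=> mA; suff : caratheodory_measurable mu (+%R t @^-1` A) by [].
move=> X; set Y := +%R (- t) @^-1` X.
have XE : X = +%R t @^-1` Y.
  by apply/seteqP; split=> x; rewrite /Y /= addrA addNr add0r.
rewrite -[LHS](completed_lebesgue_measure_addr (- t)) -/Y [LHS]mA.
by rewrite [in RHS]XE; congr (_ + _)%E; symmetry;
  apply: completed_lebesgue_measure_addr.
Qed.

Lemma lebesgue_measurable_fun_addr t (h : R -> R) :
  lebesgue_measurable_fun h -> lebesgue_measurable_fun (h \o +%R t).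
Proof.
move=> mh _ Y mY; rewrite setTI comp_preimage.
apply: lebesgue_measurable_addr.
by have := mh measurableT Y mY; rewrite setTI.
Qed.

Lemma borel_lebesgue_measurable A : measurable A -> lebesgue_measurable A.
Proof. by move=> mA; apply: sub_caratheodory. Qed.

(* The pushforward of the completed measure along this map is the Borel one. *)
Definition lebesgue_to_borel : lebesgueTypeR R -> measurableTypeR R :=
  fun x => x.

Lemma measurable_lebesgue_to_borel : measurable_fun setT lebesgue_to_borel.
Proof. by move=> _ Y mY; rewrite setTI; apply: borel_lebesgue_measurable. Qed.

HB.instance Definition _ := isMeasurableFun.Build _ _ _ _ lebesgue_to_borel
  measurable_lebesgue_to_borel.

Lemma borel_lebesgue_measurable_fun d (T : measurableType d) (f : R -> T) :
  measurable_fun setT f -> measurable_fun setT (f : lebesgueTypeR R -> T).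
Proof.
by move=> mf; exact: measurableT_comp mf measurable_lebesgue_to_borel.
Qed.

(** Lets results on the Borel measure, such as the fundamental theorem of calculus and substitution,
    evaluate integrals against [mu]. *)
Lemma ge0_integral_completed_lebesgue D (f : R -> \bar R) :
  measurable D -> measurable_fun D f -> (forall x, D x -> 0 <= f x)%E ->
  (\int[mu]_(x in D) f x = \int[lambda]_(x in D) f x)%E.
Proof.
move=> mD mf f0.
have := ge0_integral_pushforward measurable_lebesgue_to_borel mu mD mf
  (fun x xD => f0 x (set_mem xD)).
move=> /esym -> /=.
by apply: (@eq_measure_integral _ (measurableTypeR R)) => A mA AD.
Qed.

(** The line is cut at 0 and the left half reflected; the endpoint 0, missing from the right half,
    is a null set. *)
Lemma ge0_integral_completed_even D (f : R -> \bar R) :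
  measurable D -> measurable_fun setT f -> (forall x, 0 <= f x)%E ->
  (\int[mu]_(x in [set x | D `|x|%R]) f `|x|%R =
   2%:E * \int[lambda]_(x in `[0%R, +oo[ `&` D) f x)%E.
Proof.
move=> mD mf f0.
pose g : R -> \bar R := (f \_ D)%E.
have g0 x : (0 <= g x)%E by rewrite /g patchE; case: ifP.
have mg : measurable_fun setT g.
  exact/(measurable_restrictT f mD)/measurable_funTS.
have mgn : measurable_fun setT (fun x : R => g `|x|%R).
  exact: (measurableT_comp mg (@normr_measurable R setT)).
have -> : (\int[mu]_(x in [set x | D `|x|%R]) f `|x|%R = \int[mu]_x g `|x|%R)%E.
  rewrite integral_mkcond; apply: eq_integral => x _; rewrite /g !patchE.
  by rewrite (_ : (_ \in _) = (`|x| \in D)).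
rewrite integral_mkcondr -/g ge0_integral_completed_lebesgue//.
have mI (i : interval R) : measurable_fun [set` i] (fun x : R => g `|x|%R).
  exact: measurable_funTS.
rewrite -(setUv `]-oo, 0%R]%classic) setCitvl ge0_integral_setU//=;
  last 2 first.
- by rewrite -setCitvl setUv.
- by rewrite disj_set2E -setCitvl setICr.
have -> : (\int[lambda]_(x in `]-oo, 0%R]) g `|x|%R =
           \int[lambda]_(x in `[0%R, +oo[) g x)%E.
  rewrite ge0_integration_by_substitution0//; apply: eq_integral => x.
  by rewrite inE/= in_itv/= => x0; rewrite ler0_norm.
have -> : (\int[lambda]_(x in `]0%R, +oo[) g `|x|%R =
           \int[lambda]_(x in `[0%R, +oo[) g x)%E.
  rewrite -[RHS]integral_itv_obnd_cbnd; last exact: measurable_funTS.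
  apply: eq_integral => x.
  by rewrite inE/= in_itv/= andbT => x0; rewrite gtr0_norm.
by rewrite mule_natl mule2n.
Qed.

End completed_lebesgue.

(** * Integrals of powers over intervals and half-lines *)

Section powR_integrals.
Context {R : realType}.
Local Notation lambda := (@lebesgue_measure R).

Lemma is_derive_powR_div (p x : R) : p != 0 -> 0 < x ->
  is_derive x 1 (fun y => y `^ p / p) (x `^ (p - 1)).
Proof.
move=> p0 x0; rewrite (_ : (fun _ => _) = p^-1 \*: (@powR R ^~ p)); last first.
  by apply/funext => y /=; rewrite mulrC.
have pd := is_derive1_powR p x0.
apply: is_derive_eq.
by rewrite /= /GRing.scale/= mulrA mulVf// mul1r.
Qed.

Lemma measurable_epowR (p : R) (D : set R) :
  measurable_fun D (fun x : R => (x `^ p)%:E).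
Proof.
by apply/measurable_EFinP; apply: measurable_funTS; exact: measurable_powR.
Qed.

Lemma integral_powR_itvcc (p a b : R) : p != 0 -> 0 < a -> a < b ->
  (\int[lambda]_(x in `[a, b]) (x `^ (p - 1))%:E =
   ((b `^ p - a `^ p) / p)%:E)%E.
Proof.
move=> p0 a0 ab; have b0 := lt_trans a0 ab.
have dF x : 0 < x -> derivable (fun y : R => y `^ p / p) x 1.
  by move=> x0; have [] := is_derive_powR_div _ _ p0 x0.
have cF x : 0 < x -> {for x, continuous (fun y : R => y `^ p / p)}.
  by move=> x0; apply/differentiable_continuous/derivable1_diffP/dF.
rewrite (@continuous_FTC2 R _ (fun y => y `^ p / p))//.
- by rewrite -EFinB -mulrBl.
- apply: derivable_within_continuous => x; rewrite in_itv/= => /andP[ax _].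
  by apply: derivable_powR; rewrite in_itv/= (lt_le_trans a0).
- split.
  + by move=> x; rewrite in_itv/= => /andP[ax _]; apply: dF; exact: lt_trans ax.
  + by apply: cvg_at_right_filter; exact: cF.
  + by apply: cvg_at_left_filter; exact: cF.
- move=> x; rewrite in_itv/= => /andP[ax _].
  rewrite derive1E.
  by have [_ ->] := is_derive_powR_div _ _ p0 (lt_trans a0 ax).
Qed.

(** The integrand may blow up at 0, so the formula on closed intervals away from 0 is extended by
    monotone convergence. *)
Lemma integral_powR_itvoc (p b : R) : 0 < p -> 0 < b ->
  (\int[lambda]_(x in `]0%R, b]) (x `^ (p - 1))%:E = (b `^ p / p)%:E)%E.
Proof.
move=> p0 b0.
(* The shift [n.+2] keeps the left endpoint strictly below [b] already for n = 0, as
   [integral_powR_itvcc] demands. *)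
pose F n : set R := `[b / n.+2%:R, b]%classic.
have Fpos n : 0 < b / n.+2%:R by rewrite divr_gt0.
have Flt n : b / n.+2%:R < b by rewrite ltr_pdivrMr// ltr_pMr// ltr1n.
have UF : \bigcup_n F n = `]0, b]%classic.
  rewrite /F; apply/seteqP.
  split=> [x [n _]|x] /=; rewrite !in_itv/= => /andP[h1 h2].
    by rewrite h2 (lt_le_trans (Fpos n)).
  exists (Num.bound (b / x)) => //=; rewrite in_itv/=.
  apply/andP; split=> //; rewrite ler_pdivrMr// mulrC -ler_pdivrMr//.
  by rewrite (le_trans (ltW (unstable.ltr_bound _)))// ler_nat -addn2 leq_addr.
rewrite -UF; apply/esym.
have mF n : measurable (F n) by exact: measurable_itv.
have cF := @ge0_nondecreasing_set_cvg_integral _ (measurableTypeR R) R F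
  (fun x => (x `^ (p - 1))%:E) lambda.
apply: (cvg_unique _ _ (cF _ _ _ _)) => //.
- have : (b `^ p - (b / n.+2%:R) `^ p) / p @[n --> \oo] --> (b `^ p - 0) / p.
    apply: cvgMr_tmp; apply: cvgB; first exact: cvg_cst.
    apply/(cvg_at_rightP (fun x => x `^ p) 0 0).1; first exact: powR_cvg0.
    split=> //; rewrite -(mulr0 b); apply: cvgMl_tmp.
    apply/cvgrPdist_lt => e e0; near=> n.
    rewrite sub0r normrN ger0_norm// (@le_lt_trans _ _ n.+1%:R^-1)//.
      by rewrite lef_pV2 ?posrE// ler_nat.
    by near: n; exact: (near_infty_natSinv_lt (PosNum e0)).
  rewrite subr0 => H.
  rewrite (_ : (fun _ => _) =
      EFin \o (fun n => (b `^ p - (b / n.+2%:R) `^ p) / p)).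
    by apply: cvg_EFin => //; exact: nearW.
  by apply/funext => n; rewrite /F integral_powR_itvcc// gt_eqF.
- move=> m n mn; apply/subsetPset => x /=.
  rewrite /F/= !in_itv/= => /andP[h1 ->].
  rewrite andbT (le_trans _ h1)// ler_pM2l// lef_pV2 ?posrE// ler_nat.
  by rewrite !ltnS.
- by move=> n; exact: measurable_epowR.
- by move=> n x _; rewrite lee_fin powR_ge0.
Unshelve. all: by end_near. Qed.

Lemma cvg_powRN_pinfty (p : R) : 0 < p -> x `^ (- p) @[x --> +oo] --> 0.
Proof.
move=> p0; apply/cvgrPdist_le => e e0.
near=> x.
(* The threshold e^(-1/p) solves x^(-p) = e. *)
have c0 : 0 < e `^ (- p^-1) by rewrite powR_gt0.
have cx : e `^ (- p^-1) <= x by near: x; exact: nbhs_pinfty_ge.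
have x0 : 0 < x by exact: lt_le_trans cx.
rewrite sub0r normrN ger0_norm ?powR_ge0// powRN.
rewrite -[leRHS]invrK lef_pV2 ?posrE ?invr_gt0 ?powR_gt0//.
have -> : e^-1 = (e `^ (- p^-1)) `^ p.
  by rewrite -powRrM mulNr mulVf ?gt_eqF// powR_inv1// ltW.
by apply: ge0_ler_powR => //; rewrite ?nnegrE ltW.
Unshelve. all: by end_near. Qed.

Lemma integral_powR_itvcy (p a : R) : 0 < p -> 0 < a ->
  (\int[lambda]_(x in `[a, +oo[) (x `^ (- p - 1))%:E = (a `^ (- p) / p)%:E)%E.
Proof.
move=> p0 a0; have pN0 : - p != 0 by rewrite oppr_eq0 gt_eqF.
have dF x : 0 < x -> derivable (fun y : R => y `^ (- p) / - p) x 1.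
  by move=> x0; have [] := is_derive_powR_div _ _ pN0 x0.
rewrite (@ge0_continuous_FTC2y R _ (fun y => y `^ (- p) / - p) _ 0).
- by rewrite -EFinB sub0r invrN mulrN opprK.
- by move=> x _; exact: powR_ge0.
- apply: derivable_within_continuous => x; rewrite in_itv/= andbT => ax.
  by apply: derivable_powR; rewrite in_itv/= (lt_le_trans a0).
- rewrite -(mul0r (- p)^-1); apply: cvgMr_tmp; exact: cvg_powRN_pinfty.
- by move=> x ax; apply: dF; exact: lt_trans ax.
- apply: cvg_at_right_filter.
  by have /derivable1_diffP/differentiable_continuous := dF a a0; exact.
- move=> x; rewrite in_itv/= andbT => ax.
  rewrite derive1E.
  by have [_ ->] := is_derive_powR_div _ _ pN0 (lt_trans a0 ax).
Qed.

End powR_integrals.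

(** * The simple pole of Gamma at 0 *)

Section Gamma_at_zero.
Context {R : realType}.
Local Notation lambda := (@lebesgue_measure R).
Implicit Types s : R.

Let gamma_fun s (u : R) := u `^ (s - 1) * expR (- u).

Let gamma_fun_ge0 s u : 0 <= gamma_fun s u.
Proof. by rewrite mulr_ge0 ?powR_ge0 ?expR_ge0. Qed.

Let measurable_gamma_fun s (D : set R) : measurable_fun D (EFin \o gamma_fun s).
Proof.
apply: measurable_funTS; apply/measurable_EFinP; apply: measurable_funM.
  exact: measurable_powR.
by apply: measurableT_comp => //; exact: measurable_expR.
Qed.

Let gamma_integral_split s :
  (\int[lambda]_(u in `]0%R, +oo[) (gamma_fun s u)%:E =
   \int[lambda]_(u in `]0%R, 1%R]) (gamma_fun s u)%:E +
   \int[lambda]_(u in `]1%R, +oo[) (gamma_fun s u)%:E)%E.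
Proof.
rewrite -ge0_integral_setU//.
- congr (integral _ _ _); apply/seteqP; split=> u /=; rewrite !in_itv/= !andbT.
    by move=> ->; case: (leP u 1) => ?; [left|right].
  by move=> [/andP[]//|]; apply: lt_trans.
- exact: measurable_gamma_fun.
- by move=> u _; rewrite lee_fin.
- rewrite disj_set2E; apply/eqP; rewrite -subset0 => u [] /=.
  by rewrite !in_itv/= andbT => /andP[_]; rewrite leNgt => /negP.
Qed.

Let le_integral_gamma s : 0 < s <= 1 ->
  (\int[lambda]_(u in `]0%R, +oo[) (gamma_fun s u)%:E <= (s^-1 + 1)%:E)%E.
Proof.
move=> /andP[s0 s1]; rewrite gamma_integral_split EFinD; apply: leeD.
  have -> : (s^-1)%:E = (1 `^ s / s)%:E by rewrite powR1 mul1r.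
  rewrite -integral_powR_itvoc//.
  apply: ge0_le_integral => //.
  - by move=> u _; rewrite lee_fin.
  - exact: measurable_gamma_fun.
  - exact: measurable_epowR.
  move=> u; rewrite /= in_itv/= => /andP[u0 _].
  by rewrite lee_fin ler_piMr ?powR_ge0// expR_le1 oppr_le0 ltW.
(* The term 1 is the total mass of the exponential law of rate 1, whose density dominates the
   integrand on ]1, +oo[. *)
have <- := @integral_exponential_pdf R 1 ltr01.
have mpdf D : measurable_fun D (fun x => (exponential_pdf (1 : R) x)%:E).
  apply: measurable_funTS; apply/measurable_EFinP.
  exact: measurable_exponential_pdf.
have pdf_ge0 x : (0 <= (exponential_pdf (1 : R) x)%:E)%E.
  by rewrite lee_fin exponential_pdf_ge0.
apply: (@le_trans _ _
    (\int[lambda]_(u in `]1%R, +oo[) (exponential_pdf (1 : R) u)%:E)%E).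
  apply: ge0_le_integral => //.
  - by move=> u _; rewrite lee_fin.
  - exact: measurable_gamma_fun.
  - exact: mpdf.
  move=> u; rewrite /= in_itv/= andbT => u1.
  have u0 : 0 < u by exact: lt_trans u1.
  rewrite lee_fin (exponential_pdfE _ (ltW u0)) mul1r mulN1r /gamma_fun.
  rewrite ler_piMl ?expR_ge0// -[leRHS](powRr0 u).
  by rewrite ler_powR ?subr_le0 ?(ltW u1).
by apply: ge0_subset_integral => //; exact: mpdf.
Qed.

Let ge_integral_gamma s : 0 < s ->
  ((s^-1)%:E <= \int[lambda]_(u in `]0%R, +oo[) (gamma_fun s u)%:E + 1)%E.
Proof.
move=> s0; have s10 : 0 < s + 1 by rewrite addr_gt0.
rewrite gamma_integral_split -addeAC.
apply: (@le_trans _ _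
    (\int[lambda]_(u in `]0%R, 1%R]) (gamma_fun s u)%:E + 1)%E); last first.
  by rewrite leeDl// integral_ge0// => u _; rewrite lee_fin.
(* The inequality 1 - u <= exp(-u) is used additively, as u^(s-1) <= u^(s-1) exp(-u) + u^s, with no
   difference of extended reals. The exponent s is spelled [s + 1 - 1] to fit [integral_powR_itvoc];
   the added integral is 1/(s+1) <= 1. *)
apply: (@le_trans _ _ (\int[lambda]_(u in `]0%R, 1%R]) (gamma_fun s u)%:E +
    \int[lambda]_(u in `]0%R, 1%R]) (u `^ (s + 1 - 1))%:E)%E); last first.
  rewrite leeD2l// integral_powR_itvoc// powR1 lee_fin mul1r invf_le1//.
  by rewrite lerDr ltW.
have -> : (s^-1)%:E = (1 `^ s / s)%:E by rewrite powR1 mul1r.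
  rewrite -integral_powR_itvoc//.
have g0 u : (0 <= (gamma_fun s u)%:E)%E by rewrite lee_fin.
have p0 p (u : R) : (0 <= (u `^ p)%:E)%E by rewrite lee_fin powR_ge0.
rewrite -ge0_integralD//; last 2 first.
- exact: measurable_gamma_fun.
- exact: measurable_epowR.
apply: ge0_le_integral => //.
- exact: measurable_epowR.
- apply: emeasurable_funD; first exact: measurable_gamma_fun.
  exact: measurable_epowR.
- move=> u; rewrite /= in_itv/= => /andP[u0 _].
  have us : u `^ (s + 1 - 1) = u `^ (s - 1) * u.
    have u_neq0 : u != 0 by rewrite gt_eqF.
    by rewrite addrAC [LHS]powRD ?u_neq0 ?implybT// powRr1 ?ltW.
  rewrite -EFinD lee_fin us -mulrDr ler_peMr ?powR_ge0// -lerBlDr.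
  exact: expR_ge1Dx.
Qed.

(* From 1 - u <= exp(-u) <= 1 on ]0, 1] and u^(s-1) <= 1 on [1, +oo[. *)
Lemma Gamma_bounds s : 0 < s <= 1 -> 1 - s <= s * Gamma s <= 1 + s.
Proof.
move=> /[dup] s01 /andP[s0 s1]; rewrite /Gamma /Rintegral.
have := le_integral_gamma s s01; have := ge_integral_gamma s s0.
have : (0 <= \int[lambda]_(u in `]0%R, +oo[) (gamma_fun s u)%:E)%E.
  by apply: integral_ge0 => u _; rewrite lee_fin.
rewrite /gamma_fun.
(* The bounds exclude infinite values, so passing to the real integral loses nothing. *)
case: (integral _ _ _) => [x||]//= _; rewrite -EFinD !lee_fin => x1 x2.
rewrite -(ler_pM2l s0) mulrDr mulfV ?gt_eqF// mulr1 in x1.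
rewrite -(ler_pM2l s0) mulrDr mulfV ?gt_eqF// mulr1 in x2.
by rewrite lerBlDr x1 x2.
Qed.

Lemma cvg_mul_Gamma : s * Gamma s @[s --> (0 : R)^'+] --> (1 : R).
Proof.
apply: (@squeeze_cvgr _ _ _ _ (fun s => 1 - s) (fun s => 1 + s)).
- near=> s; apply: Gamma_bounds; apply/andP; split.
    by near: s; exact: nbhs_right_gt.
  by near: s; exact: nbhs_right_le.
- rewrite -[X in _ --> X]subr0; apply: cvgB; first exact: cvg_cst.
  exact: cvg_at_right_filter.
- rewrite -[X in _ --> X]addr0; apply: cvgD; first exact: cvg_cst.
  exact: cvg_at_right_filter.
Unshelve. all: by end_near. Qed.

End Gamma_at_zero.

(** * Integrability of 1/|tau| over the complement near the point *)

Section thin_complement.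
Context {R : realType}.
Local Notation mu := (@completed_lebesgue_measure R).

Lemma preimage_addr_closed_ball (t d : R) (Omega : set R) :
  [set tau | `|tau| <= d] `&` ~` [set tau | Omega (t + tau)] =
  +%R t @^-1` (`[t - d, t + d]%classic `&` ~` Omega).
Proof.
by apply/seteqP; split=> x /=; rewrite in_itv/= !lerD2l ler_norml.
Qed.

Lemma lebesgue_measurable_closed_ball (d : R) :
  lebesgue_measurable [set tau : R | `|tau| <= d].
Proof.
apply: borel_lebesgue_measurable.
rewrite (_ : [set _ | _] = `[- d, d]%classic) //.
by apply/seteqP; split=> x /=; rewrite in_itv/= ler_norml.
Qed.

(** The least exponent with d / 2^n < x is not 0 because x <= d; its predecessor is [k], and
    minimality gives the upper bound on x. *)
Lemma exists_dyadic_bracket (d x : R) : 0 < x -> x <= d ->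
  exists k : nat, x <= d / 2 ^+ k /\ d / 2 ^+ k.+1 < x.
Proof.
move=> x0 xd.
have ex : exists k, d / 2 ^+ k < x.
  exists (Num.bound (d / x)).
  rewrite ltr_pdivrMr ?exprn_gt0// mulrC -ltr_pdivrMr//.
  exact: upper_nthrootP.
case: (ex_minnP ex) => -[|k] hk mk.
  by move: hk; rewrite expr0 divr1 ltNge xd.
exists k; split=> //; rewrite leNgt; apply/negP => /mk.
by rewrite ltnn.
Qed.

Lemma measure_complement_le (beta : R) Omega t :
  complement_thin beta Omega t ->
  exists2 d0 : R, 0 < d0 & forall d, 0 < d <= d0 ->
  (mu ([set tau : R | `|tau| <= d]%R `&` ~` [set tau | Omega (t + tau)%R]) <=
   (d `^ beta)%:E)%E.
Proof.
move=> /cvgrPdist_le/(_ 1 ltr01)[e /= e0 He].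
(* Halving puts the closed range d <= e / 2 inside the open ball of radius e. *)
exists (e / 2) => [|d /andP[d0 de]]; first by rewrite divr_gt0.
have : ball_ Num.norm 0 e d.
  rewrite /ball_/= sub0r normrN gtr0_norm// (le_lt_trans de)//.
  by rewrite ltr_pdivrMr// ltr_pMr// ltr1n.
move=> /He/(_ d0)/=; rewrite sub0r normrN.
rewrite preimage_addr_closed_ball completed_lebesgue_measure_addr.
set A := (_ `&` ~` Omega).
(* The hypothesis concerns [fine], which sends +oo to 0, so finiteness must be known before the
   bound is read in the extended reals. *)
have : (mu A < +oo)%E.
  apply: (@le_lt_trans _ _ (mu `[t - d, t + d]%classic)).
    by apply: le_outer_measure; exact: subIsetl.
  rewrite (_ : mu _ = lebesgue_measure `[t - d, t + d]%classic)//.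
  by rewrite lebesgue_measure_itv/= -EFinD; case: ifP => _; rewrite ltry.
have : (0 <= mu A)%E by exact: measure_ge0.
case: (mu A) => [r| |]//=; rewrite !lee_fin => r0 _.
by rewrite ger0_norm ?divr_ge0 ?powR_ge0// ler_pdivrMr ?powR_gt0// mul1r.
Qed.

(* If d / 2^(k+1) < |tau| <= d / 2^k, then 1 / |tau| is at most
   c k = 2^(k+1) / d; weighting by the measure of the k-th piece leaves a
   geometric series of ratio 2^(1 - beta). *)
Lemma integral_inv_thin_complement (beta : R) Omega t : 1 < beta ->
  lebesgue_measurable Omega -> complement_thin beta Omega t ->
  exists2 d0 : R, 0 < d0 &
  (\int[mu]_(tau in [set tau : R | `|tau| <= d0]%R `&`
                    ~` [set tau | Omega (t + tau)%R])
    (`|tau|^-1)%:E < +oo)%E.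
Proof.
move=> b1 mO /measure_complement_le[d d0 Hd]; exists d => //.
pose D k : set (lebesgueTypeR R) :=
  [set tau : R | `|tau| <= d / 2 ^+ k] `&` ~` [set tau | Omega (t + tau)].
have mD k : measurable (D k).
  apply: measurableI; first exact: lebesgue_measurable_closed_ball.
  by apply: measurableC; exact: lebesgue_measurable_addr.
have D0 :
  [set tau : R | `|tau| <= d] `&` ~` [set tau | Omega (t + tau)] = D 0%N.
  by rewrite /D expr0 divr1.
rewrite D0.
pose c k : R := 2 ^+ k.+1 / d.
have c0 k : 0 <= c k by rewrite divr_ge0 ?exprn_ge0 ?ltW.
pose u k (x : R) : \bar R := (c k * \1_(D k) x)%:E.
have u0 k x : (0 <= u k x)%E by rewrite lee_fin mulr_ge0.
have mu_ k (E : set (lebesgueTypeR R)) :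
  measurable_fun E (u k : lebesgueTypeR R -> _).
  by apply/measurable_EFinP; exact: measurable_funM.
(* The sets [D k] are nested, not disjoint: at each nonzero point the single term given by its
   dyadic bracket bounds 1/|x|, and the other terms are nonnegative. *)
apply: (@le_lt_trans _ _ (\int[mu]_(x in D 0%N) (\sum_(0 <= k <oo) u k x))%E).
  apply: ge0_le_integral => //.
  - apply: measurable_funTS; apply: borel_lebesgue_measurable_fun.
    apply/measurable_EFinP.
    rewrite (_ : (fun _ => _) = (@powR R ^~ (-1)) \o Num.norm).
      apply: measurableT_comp; first exact: measurable_powR.
      exact: normr_measurable.
    by apply/funext => x /=; rewrite powR_inv1.
  - exact: ge0_emeasurable_sum.
  - move=> x; rewrite -D0 => -[/= xd Ox].
    (* At 0 the inverse takes the default value 0. *)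
    have [->|x0] := eqVneq x 0; first by rewrite normr0 invr0 nneseries_ge0.
    have [||k [h1 h2]] := exists_dyadic_bracket d `|x| => //.
      by rewrite normr_gt0.
    have := @nneseries_lim_ge R (u ^~ x) xpredT 0 k.+1 (fun n _ _ => u0 n x).
    apply: le_trans.
    rewrite big_nat_recr//= (le_trans _ (leeDr _ _))//; last first.
      by rewrite sume_ge0.
    rewrite /u indicE mem_set // mulr1 lee_fin /c.
    rewrite -[leRHS]invrK invf_div.
    rewrite lef_pV2 ?posrE ?normr_gt0 ?divr_gt0 ?exprn_gt0//.
    exact: ltW.
rewrite integral_nneseries//.
(* From c k * (d / 2^k)^beta = 2 d^(beta-1) * (2^(1-beta))^k; the ratio [z] is below 1 since beta >
   1. *)
pose a := 2 * d `^ (beta - 1); pose z : R := 2 `^ (1 - beta).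
have a0 : 0 <= a by rewrite mulr_ge0 ?powR_ge0.
have z0 : 0 < z by rewrite powR_gt0.
have z1 : z < 1.
  rewrite /z -opprB powRN invf_lt1 ?powR_gt0//.
  rewrite [ltLHS](_ : 1 = 1 `^ (beta - 1)); last by rewrite powR1.
  by rewrite gt0_ltr_powR ?nnegrE ?subr_gt0// ltr1n.
have term k : (\int[mu]_(x in D 0%N) u k x <= (geometric a z k)%:E)%E.
  under eq_integral do rewrite /u EFinM.
  rewrite ge0_integralZl_EFin//; last first.
    by apply/measurable_EFinP; exact: measurable_indic.
  rewrite integral_indic//.
  apply: (@le_trans _ _ ((c k)%:E * ((d / 2 ^+ k) `^ beta)%:E)%E).
    apply: lee_wpmul2l; first by rewrite lee_fin.
    apply: (le_trans _ (Hd _ _)).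
      by apply: le_outer_measure; exact: subIsetl.
    rewrite divr_gt0 ?exprn_gt0//= ler_pdivrMr ?exprn_gt0//.
    by rewrite ler_peMr ?(ltW d0)// exprn_ege1// ler1n.
  rewrite -EFinM lee_fin /geometric/= /a /c /z.
  have -> : (d / 2 ^+ k) `^ beta = d `^ beta / (2 `^ beta) ^+ k.
    rewrite powRM ?invr_ge0 ?exprn_ge0 ?(ltW d0)//; congr (_ * _).
    rewrite -[in LHS]powR_invn// -powRrM mulNr powRN.
    by rewrite mulrC powRrM powR_mulrn ?powR_ge0.
  have d_neq0 : d != 0 by rewrite gt_eqF.
  rewrite [d `^ (_ - _)]powRB ?d_neq0 ?implybT//.
  rewrite [2 `^ (_ - _)]powRB ?pnatr_eq0 ?implybT//.
  rewrite !powRr1 ?(ltW d0)// expr_div_n exprS.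
  by rewrite le_eqVlt; apply/orP; left; apply/eqP; ring.
apply: (@le_lt_trans _ _ (a / (1 - z))%:E); last exact: ltry.
apply: (@le_trans _ _ (\sum_(0 <= k <oo) (geometric a z k)%:E)%E).
  by apply: lee_nneseries => // k _ _; exact: integral_ge0.
apply: lime_le.
  by apply: is_cvg_nneseries => k _ _; rewrite lee_fin geometric_ge0// ltW.
apply: nearW => n; rewrite sumEFin lee_fin.
by rewrite geometric_le_lim// gtr0_norm.
Qed.
End thin_complement.

(** * Powers of |x| inside and outside a ball, and measurability of the kernel's factors *)

Section singular_integrals.
Context {R : realType}.
Local Notation mu := (@completed_lebesgue_measure R).
Local Notation lambda := (@lebesgue_measure R).

(** Used with p = s, where s times this value is the mass 2 d^s of the approximate identity. *)
Lemma integral_powR_norm_le (p d : R) : 0 < p -> 0 < d ->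
  (\int[mu]_(x in [set x : R | `|x| <= d]%R) (`|x| `^ (p - 1))%:E =
   (2 * (d `^ p / p))%:E)%E.
Proof.
move=> p0 d0.
have -> : [set x : R | `|x| <= d] = [set x | `]-oo, d]%classic `|x| ].
  by apply/seteqP; split=> x /=; rewrite in_itv.
rewrite (ge0_integral_completed_even _ (fun x => (x `^ (p - 1))%:E))//;
  last 2 first.
- exact: measurable_epowR.
- by move=> x; rewrite lee_fin powR_ge0.
rewrite (_ : _ `&` _ = `[0, d]%classic); last first.
  by apply/seteqP; split=> x /=; rewrite !in_itv/= andbT => /andP.
rewrite -integral_itv_obnd_cbnd; last exact: measurable_epowR.
by rewrite integral_powR_itvoc// EFinM.
Qed.

(** Used with p = z - s, so that the exponent is -(1 + eta): this is the tail of the kernel. *)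
Lemma integral_powR_norm_gt (p d : R) : 0 < p -> 0 < d ->
  (\int[mu]_(x in [set x : R | d < `|x|]%R) (`|x| `^ (- p - 1))%:E =
   (2 * (d `^ (- p) / p))%:E)%E.
Proof.
move=> p0 d0.
have -> : [set x : R | d < `|x|] = [set x | `]d, +oo[%classic `|x| ].
  by apply/seteqP; split=> x /=; rewrite in_itv/= andbT.
rewrite (ge0_integral_completed_even _ (fun x => (x `^ (- p - 1))%:E))//;
  last 2 first.
- exact: measurable_epowR.
- by move=> x; rewrite lee_fin powR_ge0.
rewrite (_ : _ `&` _ = `]d, +oo[%classic); last first.
  apply/seteqP; split=> x /=; rewrite !in_itv/= !andbT; first by case.
  by move=> dx; split=> //; rewrite ltW// (lt_trans d0).
rewrite integral_itv_obnd_cbnd; last exact: measurable_epowR.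
by rewrite integral_powR_itvcy// EFinM.
Qed.

(** Extending by zero to the whole line allows functions supported on different sets to be combined
    under one integral. *)
Lemma Rintegral_restrict (D : set R) (f : R -> R) (c : R) :
  lebesgue_measurable D -> lebesgue_measurable_fun f -> (forall x, 0 <= f x) ->
  (\int[mu]_(x in D) (f x)%:E = c%:E)%E ->
  mu.-integrable setT (EFin \o (f \_ D)) /\ \int[mu]_x (f \_ D) x = c.
Proof.
move=> mD mf f0 Hc.
have fD0 x : 0 <= (f \_ D) x by rewrite patchE; case: ifP.
split; last by rewrite -Rintegral_mkcond /Rintegral Hc.
rewrite -restrict_EFin; apply/(integrable_mkcond _ mD).
apply/integrableP; split.
  by apply/measurable_EFinP; exact: measurable_funTS.
under eq_integral do rewrite gee0_abs ?lee_fin//.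
by rewrite Hc ltry.
Qed.

Lemma lebesgue_measurable_powR_norm p :
  lebesgue_measurable_fun (fun x : R => `|x| `^ p).
Proof.
apply: borel_lebesgue_measurable_fun.
apply: (measurableT_comp (@measurable_powR R p)); exact: normr_measurable.
Qed.

Lemma lebesgue_measurable_sg : lebesgue_measurable_fun (@Num.sg R).
Proof.
apply: borel_lebesgue_measurable_fun.
have -> : @Num.sg R = \1_`]0, +oo[%classic \- \1_`]-oo, 0[%classic.
  apply/funext => x /=; rewrite !indicE.
  have [x0|x0|->] := ltgtP x 0.
  - rewrite ltr0_sg// (mem_set (_ : `]-oo, 0[%classic x))
      ?memNset/= ?in_itv//= ?andbT.
      by rewrite sub0r.
    by apply/negP; rewrite -leNgt ltW.
  - rewrite gtr0_sg// (mem_set (_ : `]0, +oo[%classic x))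
      ?memNset/= ?in_itv//= ?x0//.
      by rewrite subr0.
    by apply/negP; rewrite -leNgt ltW.
  - by rewrite sgr0 !memNset ?subrr//= in_itv/= ltxx.
by apply: measurable_funB; exact: measurable_indic.
Qed.

End singular_integrals.

(** Integrability of [f] is derived from f = (f - g) + g, where f - g is dominated by [h]. *)
Lemma le_dist_Rintegral d (T : measurableType d) (R : realType)
    (m : {measure set T -> \bar R}) (f g h : T -> R) :
  measurable_fun setT f -> m.-integrable setT (EFin \o g) ->
  m.-integrable setT (EFin \o h) -> (forall x, `|f x - g x| <= h x) ->
  `|\int[m]_x f x - \int[m]_x g x| <= \int[m]_x h x.
Proof.
move=> mf ig ih fgh.
have mg : measurable_fun setT g.
  by apply/measurable_EFinP; exact: measurable_int ig.
have ifg : m.-integrable setT (EFin \o (fun x => f x - g x)).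
  apply: (le_integrable _ _ _ ih) => //.
    by apply/measurable_EFinP; exact: measurable_funB.
  by move=> x _; rewrite /= lee_fin (le_trans (fgh x))// ler_norm.
have if_ : m.-integrable setT (EFin \o f).
  have := integrableD measurableT ifg ig; apply: eq_integrable => // x _ /=.
  by rewrite -EFinD subrK.
rewrite -RintegralB//; apply: le_trans (le_normr_Rintegral _ _) _ => //.
apply: le_Rintegral => //.
exact: integrable_norm ifg.
Qed.

(** * Estimate of the singular integral for a fixed s *)

Section estimate.
Context {R : realType}.
Local Notation mu := (@completed_lebesgue_measure R).
Context (E : set R) (q : R -> R) (K z a d0 : R).
Context (mE : lebesgue_measurable E) (mq : lebesgue_measurable_fun q).
Context (qK : forall x, `|q x| <= K).

(** Here [q] plays the real or imaginary part of g (t + x) - g t, [E] is Omega - t, and z - s is the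
    order eta. *)
Local Notation kernel s x := (q x / `|x| `^ (1 + (z - s)) * Num.sg x).
Local Notation N := ([set x : R | `|x| <= d0]%R `&` ~` E).
Context (Nfin : (\int[mu]_(x in N) (`|x|^-1)%:E < +oo)%E).

Let measurable_kernel s : lebesgue_measurable_fun (fun x => kernel s x).
Proof.
apply: measurable_funM; last exact: lebesgue_measurable_sg.
apply: measurable_funM => //.
under eq_fun do rewrite -powRN.
exact: lebesgue_measurable_powR_norm.
Qed.

(** Splits the kernel into the difference quotient of order [z] and the weight |x|^(s-1); a nonzero
    sign is its own inverse. *)
Let kernel_factor s x : x != 0 ->
  kernel s x = q x / (Num.sg x * `|x| `^ z) * `|x| `^ (s - 1).
Proof.
move=> x0; have nx0 : `|x| != 0 by rewrite normr_eq0.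
rewrite invfM (_ : s - 1 = z - (1 + (z - s))); last by ring.
rewrite [_ `^ (z - _)]powRB ?nx0 ?implybT//.
have -> : (Num.sg x)^-1 = Num.sg x.
  by case: sgrP x0 => // _ _; rewrite ?invrN ?invr1.
by field; rewrite !powR_eq0 !negb_and nx0.
Qed.

(** The kernel on [E] is compared pointwise with a |x|^(s-1) on the ball of radius d. The three
    errors come from [E] inside the ball (difference quotient within e of a), the ball outside [E]
    (only the model survives), and [E] outside the ball (|q| <= K). *)
Lemma kernel_integral_estimate (s d e : R) : 0 < s -> s < 1 -> s < z ->
  0 < d <= d0 -> d <= 1 -> 0 <= e ->
  (forall x, E x -> x != 0 -> `|x| <= d ->
     `|q x / (Num.sg x * `|x| `^ z) - a| <= e) ->
  `|\int[mu]_(x in E) kernel s x - a * (2 * (d `^ s / s))| <=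
  e * (2 * (d `^ s / s)) + `|a| * fine (\int[mu]_(x in N) (`|x|^-1)%:E)%E
  + K * (2 * (d `^ (- (z - s)) / (z - s))).
Proof.
move=> s0 s1 sz /andP[dgt0 dd0] d1 e0 He.
set J := fine _.
pose w (x : R) : R := `|x| `^ (s - 1).
pose y (x : R) : R := `|x| `^ (- (z - s) - 1).
pose v (x : R) : R := `|x|^-1.
have mB : lebesgue_measurable [set x : R | `|x| <= d].
  exact: lebesgue_measurable_closed_ball.
have mN : lebesgue_measurable N.
  apply: measurableI; last exact: measurableC.
  exact: lebesgue_measurable_closed_ball.
have mBc : lebesgue_measurable [set x : R | d < `|x|].
  rewrite (_ : [set _ | _] = ~` [set x : R | `|x| <= d]).
    exact: measurableC.
  by apply/seteqP; split=> x /=; rewrite ltNge => /negP.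
have mv : lebesgue_measurable_fun v.
  rewrite (_ : v = fun x => `|x| `^ (-1)).
    exact: lebesgue_measurable_powR_norm.
  by apply/funext => x; rewrite powR_inv1.
have [iw Iw] := Rintegral_restrict _ w _ mB (lebesgue_measurable_powR_norm _)
  (fun x => powR_ge0 _ _) (integral_powR_norm_le _ _ s0 dgt0).
have zs0 : 0 < z - s by rewrite subr_gt0.
have [iy Iy] := Rintegral_restrict _ y _ mBc (lebesgue_measurable_powR_norm _)
  (fun x => powR_ge0 _ _) (integral_powR_norm_gt _ _ zs0 dgt0).
have JE : (\int[mu]_(x in N) (v x)%:E = J%:E)%E.
  by rewrite fineK// ge0_fin_numE// integral_ge0// => x _;
    rewrite lee_fin invr_ge0.
have [|iv Iv] := Rintegral_restrict _ v _ mN mv _ JE.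
  by move=> x; rewrite invr_ge0.
rewrite -Iw -Iv -Iy Rintegral_mkcond.
have iZ c (f : R -> R) : mu.-integrable setT (EFin \o f) ->
    mu.-integrable setT (EFin \o (fun x => c * f x)).
  by move=> /(integrableZl measurableT c); apply: eq_integrable.
rewrite -!RintegralZl//.
have iD (f g : R -> R) : mu.-integrable setT (EFin \o f) ->
    mu.-integrable setT (EFin \o g) ->
    mu.-integrable setT (EFin \o (fun x => f x + g x)).
  by move=> /(integrableD measurableT) /[apply]; apply: eq_integrable.
rewrite -RintegralD//; [|exact: iZ..].
rewrite -RintegralD//; [|by [apply: iD; exact: iZ|exact: iZ]..].
apply: le_dist_Rintegral.
- apply/(measurable_restrictT _ mE); apply: measurable_funTS.
  exact: measurable_kernel.
- exact: iZ.
- by apply: (iD); [apply: (iD)|]; exact: iZ.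
move=> x.
have K0 : 0 <= K by exact: le_trans (qK 0).
have res0 (D : set R) (f : R -> R) : (forall x, 0 <= f x) -> 0 <= (f \_ D) x.
  by move=> f0; rewrite patchE; case: ifP.
have Hw : 0 <= e * (w \_ [set x0 | `|x0| <= d]) x.
  by rewrite mulr_ge0// res0// => ?; exact: powR_ge0.
have Hv : 0 <= `|a| * (v \_ N) x.
  by rewrite mulr_ge0// res0// => ?; rewrite invr_ge0.
have Hy : 0 <= K * (y \_ [set x0 | d < `|x0|]) x.
  by rewrite mulr_ge0// res0// => ?; exact: powR_ge0.
(* At 0 both terms of the difference vanish: sg 0 = 0 and 0 `^ (s - 1) = 0. *)
have [x0|x0] := eqVneq x 0.
  have w0 : w x = 0 by rewrite /w x0 normr0 powR0// lt_eqF// subr_lt0.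
  rewrite [X in `|X - _|](_ : _ = 0); last first.
    by rewrite patchE; case: ifP => // _; rewrite x0 sgr0 mulr0.
  rewrite [X in `|_ - a * X|](_ : _ = 0) ?mulr0 ?subr0 ?normr0 ?addr_ge0//.
  by rewrite patchE w0; case: ifP.
have nx0 : 0 < `|x| by rewrite normr_gt0.
have [xE|xE] := pselect (E x); have [xB|xB] := leP `|x| d.
- apply: (le_trans _ (ler_wpDr Hy (ler_wpDr Hv (lexx _)))).
  rewrite !patchE !mem_set//= kernel_factor// -mulrBl normrM.
  by rewrite (ger0_norm (powR_ge0 _ _)) ler_wpM2r ?powR_ge0// He.
- apply: (le_trans _ (ler_wpDl (addr_ge0 Hw Hv) (lexx _))).
  rewrite !patchE (mem_set xE) memNset/=; last by rewrite leNgt xB.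
  rewrite mem_set//= mulr0 subr0 !normrM normr_sg x0 mulr1.
  rewrite /y -opprD powRN addrC normfV (ger0_norm (powR_ge0 _ _)).
  by rewrite ler_wpM2r ?invr_ge0 ?powR_ge0.
(* Off [E] but in the ball, |x|^(s-1) <= 1/|x| because |x| <= d <= 1 and s > 0; d <= d0 puts x in
   [N]. *)
- apply: (le_trans _ (ler_wpDr Hy (ler_wpDl Hw (lexx _)))).
  rewrite !patchE (memNset xE) [x \in _ `&` _]mem_set/=; last first.
    by split => //=; exact: le_trans dd0.
  rewrite mem_set//= sub0r normrN normrM ler_wpM2l//.
  rewrite ger0_norm ?powR_ge0// /v -powR_inv1//.
  apply: ger_powR; first by rewrite nx0 (le_trans xB).
  by rewrite lerBrDr addNr ltW.
- rewrite [X in `|X - _|](_ : _ = 0); last by rewrite patchE memNset.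
  rewrite [X in `|_ - a * X|](_ : _ = 0) ?mulr0 ?subr0 ?normr0 ?addr_ge0//.
  by rewrite patchE memNset//= leNgt xB.
Qed.

End estimate.

(** * Passage to the limit s -> 0+ *)

Section limit.
Context {R : realType}.
Local Notation mu := (@completed_lebesgue_measure R).

Lemma cvg_powR_exponent0 (d : R) : 0 < d -> d `^ s @[s --> (0 : R)] --> (1 : R).
Proof.
move=> d0; rewrite -[X in _ --> X]expR0.
rewrite (_ : (fun s => _) = fun s => expR (s * ln d)); last first.
  by apply/funext => s; rewrite /powR gt_eqF.
apply: continuous_cvg; first exact: continuous_expR.
by rewrite -[X in _ --> X](mul0r (ln d)); apply: cvgMr_tmp; exact: cvg_id.
Qed.

(** The radius d is fixed first, from the differentiability at tolerance e / 4; only then does s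
    tend to 0. The weight's mass 2 d^s <= 2 turns e / 4 into e / 2, and the other half of e absorbs
    the remaining terms. *)
Lemma cvg_kernel_integral (E : set R) (q : R -> R) (K z a d0 : R) :
  lebesgue_measurable E -> lebesgue_measurable_fun q ->
  (forall x, `|q x| <= K) -> 0 < z -> 0 < d0 ->
  (\int[mu]_(x in [set x : R | `|x| <= d0]%R `&` ~` E) (`|x|^-1)%:E < +oo)%E ->
  q x / (Num.sg x * `|x| `^ z) @[x --> within E 0^'] --> a ->
  s * \int[mu]_(x in E) (q x / `|x| `^ (1 + (z - s)) * Num.sg x)
    @[s --> 0^'+] --> 2 * a.
Proof.
move=> mE mq qK z0 d00 Nfin qa; apply/cvgrPdist_le => e e0.
have e40 : 0 < e / 4 by rewrite divr_gt0.
have K0 : 0 <= K by exact: le_trans (qK 0).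
move/cvgrPdist_le : qa => /(_ _ e40)[r /= r0 Hr].
pose d := Num.min (Num.min d0 1) (r / 2).
have d_gt0 : 0 < d by rewrite !lt_min d00 ltr01 divr_gt0.
have dd0 : d <= d0 by rewrite !ge_min lexx.
have d1 : d <= 1 by rewrite !ge_min lexx orbT.
have dr : d < r by rewrite gt_min ltr_pdivrMr// ltr_pMr// ltr1n orbT.
pose J := fine (\int[mu]_(x in [set x : R | `|x| <= d0]%R `&` ~` E)
  (`|x|^-1)%:E)%E.
(* A bound independent of s for the last two errors: when s < z / 2 and d <= 1, d^(-(z-s)) <= d^(-z)
   and z - s >= z / 2. *)
pose M := `|a| * J + K * (2 * (d `^ (- z) / (z / 2))).
have H : `|2 * a| * `|1 - d `^ s| + s * M @[s --> 0^'+] --> (0 : R).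
  rewrite -[X in _ --> X](_ : `|2 * a| * `|1 - 1 : R| + 0 * M = 0); last first.
    by rewrite subrr normr0 mulr0 mul0r addr0.
  apply: cvg_at_right_filter; apply: cvgD; last exact: cvgMr_tmp.
  apply: cvgMl_tmp; apply: cvg_norm; apply: cvgB; first exact: cvg_cst.
  exact: cvg_powR_exponent0.
have e20 : 0 < e / 2 by rewrite divr_gt0.
move/cvgrPdist_le : H => /(_ _ e20) H.
near=> s.
have s0 : 0 < s by near: s; exact: nbhs_right_gt.
have s1 : s < 1 by near: s; exact: nbhs_right_lt.
have sz : s < z / 2 by near: s; apply: nbhs_right_lt; rewrite divr_gt0.
have sz' : s < z by lra.
have : `|0 - (`|2 * a| * `|1 - d `^ s| + s * M)| <= e / 2 by near: s.
rewrite sub0r normrN => /(le_trans (ler_norm _)) Hs.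
have := kernel_integral_estimate E q K z a d0 mE mq qK Nfin s d (e / 4)
  s0 s1 sz'.
rewrite d_gt0 dd0 => /(_ isT d1 (ltW e40)).
set I := \int[mu]_(x in E) _; rewrite -/J => Hest.
have {}Hest : `|I - a * (2 * (d `^ s / s))| <= e / 4 * (2 * (d `^ s / s)) + M.
  apply: (le_trans (Hest _)).
    move=> x Ex x0 xd; rewrite distrC; apply: Hr => //=.
    by rewrite sub0r normrN (le_lt_trans xd).
  rewrite -addrA lerD2l lerD2l ler_wpM2l// ler_wpM2l//.
  apply: ler_pM; rewrite ?powR_ge0 ?invr_ge0 ?subr_ge0 ?(ltW sz')//.
    by apply: ger_powR; rewrite ?d_gt0//; lra.
  by rewrite lef_pV2 ?posrE; lra.
have ds1 : d `^ s <= 1.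
  by rewrite -(powRr0 d); apply: ger_powR; rewrite ?d_gt0// ltW.
(* The first term is the mass that the weight lacks on the ball, the second is s times the estimated
   error. *)
have -> : 2 * a - s * I =
    2 * a * (1 - d `^ s) - s * (I - a * (2 * (d `^ s / s))).
  by field; rewrite gt_eqF.
have h1 : s * `|I - a * (2 * (d `^ s / s))| <= e / 2 * d `^ s + s * M.
  apply: (le_trans (ler_wpM2l (ltW s0) Hest)); rewrite mulrDr lerD2r.
  by rewrite le_eqVlt; apply/orP; left; apply/eqP; field; rewrite gt_eqF.
have h2 : e / 2 * d `^ s <= e / 2 by rewrite ler_piMr// ltW.
apply: (le_trans (ler_normB _ _)).
rewrite (normrM (2 * a)) (normrM s) (gtr0_norm s0); lra.
Unshelve. all: by end_near. Qed.
End limit.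

(** * Complex limits through real and imaginary parts *)

Section complex_limits.
Context {R : realType}.
Implicit Types z l : R[i].
Local Notation Re := (@complex.Re R).
Local Notation Im := (@complex.Im R).

Lemma normc_i : `|'i%C : R[i]| = 1.
Proof. by rewrite normc_def/= expr0n expr1n add0r sqrtr1. Qed.

Lemma normc_real (x : R) : `|x%:C| = `|x|%:C.
Proof. by rewrite normc_def/= expr0n addr0 sqrtr_sqr. Qed.

(** Multiplication by i preserves the modulus and turns the imaginary part into a real part, up to
    sign. *)
Lemma normc_ge_Im z : `|Im z|%:C <= `|z|.
Proof.
have := normc_ge_Re (z * 'i%C).
by rewrite ReiNIm normrN normrM normc_i mulr1.
Qed.

Lemma cvg_complex_Re T (F : set_system T) {FF : Filter F} (f : T -> R[i]) l :
  f x @[x --> F] --> l -> Re (f x) @[x --> F] --> Re l.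
Proof.
move=> /cvgrPdist_lt fl; apply/cvgrPdist_lt => e e0.
have /fl : (0 : R[i]) < e%:C by rewrite ltcR.
apply: filterS => x; rewrite -ltcR; apply: le_lt_trans.
by rewrite -raddfB normc_ge_Re.
Qed.

Lemma cvg_complex_Im T (F : set_system T) {FF : Filter F} (f : T -> R[i]) l :
  f x @[x --> F] --> l -> Im (f x) @[x --> F] --> Im l.
Proof.
move=> /cvgrPdist_lt fl; apply/cvgrPdist_lt => e e0.
have /fl : (0 : R[i]) < e%:C by rewrite ltcR.
apply: filterS => x; rewrite -ltcR; apply: le_lt_trans.
by rewrite -raddfB normc_ge_Im.
Qed.

Lemma cvg_complex T (F : set_system T) {FF : Filter F} (f : T -> R[i]) l :
  Re (f x) @[x --> F] --> Re l -> Im (f x) @[x --> F] --> Im l ->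
  f x @[x --> F] --> l.
Proof.
move=> /cvgrPdist_lt fr /cvgrPdist_lt fi; apply/cvgrPdist_lt => e.
(* Positivity in [R[i]] forces a zero imaginary part, so [e] is the real number [Re e], shared
   equally between the two parts. *)
rewrite ltcE/= => /andP[/eqP e_im e_re].
have e20 : 0 < Re e / 2 by rewrite divr_gt0.
near=> x.
have h1 : `|Re l - Re (f x)| < Re e / 2 by near: x; exact: fr.
have h2 : `|Im l - Im (f x)| < Re e / 2 by near: x; exact: fi.
rewrite [l - f x]complexE !raddfB/=.
apply: (le_lt_trans (ler_normD _ _)).
rewrite normrM normc_i mul1r -!raddfB/= !normc_real -raddfD/=.
rewrite ltcE/= e_im eqxx/= 2!raddfB/=; lra.
Unshelve. all: by end_near. Qed.

End complex_limits.

(** * Normalized Whitney--Marchaud integrals and the two limits *)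

Section whitney.
Context {R : realType}.
Local Notation mu := (@completed_lebesgue_measure R).
Local Notation Re := (@complex.Re R).
Local Notation Im := (@complex.Im R).
Implicit Types (w : R[i]).

Lemma Re_mulC w (x : R) : Re (w * x%:C) = Re w * x.
Proof. by case: w => u v /=; rewrite mulr0 subr0. Qed.

Lemma Im_mulC w (x : R) : Im (w * x%:C) = Im w * x.
Proof. by case: w => u v /=; rewrite mulr0 add0r. Qed.

Lemma Re_Cmul w (x : R) : Re (x%:C * w) = x * Re w.
Proof. by rewrite mulrC Re_mulC mulrC. Qed.

Lemma Im_Cmul w (x : R) : Im (x%:C * w) = x * Im w.
Proof. by rewrite mulrC Im_mulC mulrC. Qed.

Lemma Re_divC w (x : R) : Re (w / x%:C) = Re w / x.
Proof. by rewrite -fmorphV Re_mulC. Qed.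

Lemma Im_divC w (x : R) : Im (w / x%:C) = Im w / x.
Proof. by rewrite -fmorphV Im_mulC. Qed.

(** Kept apart from its normalizing factor, which differs between the two limits. *)
Definition marchaud_integral (eta : R) (Omega : set R) (g : R -> R[i])
    (t : R) : R[i] :=
  cintegral [set tau | Omega (t + tau)]
    (fun tau => (g (t + tau) - g t) / (`|tau| `^ (1 + eta))%:C *
                (Num.sg tau)%:C).

Lemma cvg_sub_at_left (z : R) : z - eta @[eta --> z^'-] --> (0 : R)^'+.
Proof.
move=> P [e /= e0 He]; exists e => //= y /= zy yz; apply: He => /=.
  by rewrite sub0r normrN.
by rewrite subr_gt0.
Qed.

(** With s = z - eta the factor is eta / (2 z) * (s Gamma s)^(-1) * s. The first two pieces tend to
    1/2 and 1, and s times the integral tends to 2 a. *)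
Lemma cvg_normalized_kernel (Omega : set R) (beta K t z a : R) (q : R -> R) :
  lebesgue_measurable Omega -> 1 < beta -> complement_thin beta Omega t ->
  lebesgue_measurable_fun q -> (forall x, `|q x| <= K) -> 0 < z ->
  q x / (Num.sg x * `|x| `^ z)
    @[x --> within [set x | Omega (t + x)] 0^'] --> a ->
  eta / (2 * z * Gamma (z - eta)) *
    \int[mu]_(x in [set x | Omega (t + x)]) (q x / `|x| `^ (1 + eta) * Num.sg x)
    @[eta --> z^'-] --> a.
Proof.
move=> mO beta1 thin mq qK z0 qa.
have [d0 d00 Nfin] := integral_inv_thin_complement _ _ _ beta1 mO thin.
have mE := lebesgue_measurable_addr t _ mO.
have H := cvg_kernel_integral _ q K z a d0 mE mq qK z0 d00 Nfin qa.
have HI := cvg_comp _ _ (cvg_sub_at_left z) H.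
have HG := cvg_comp _ _ (cvg_sub_at_left z) (@cvg_mul_Gamma R).
have Heta : eta @[eta --> z^'-] --> z by exact: cvg_at_left_filter.
have HC : eta / (2 * z) * ((z - eta) * Gamma (z - eta))^-1
    @[eta --> z^'-] --> (2^-1 : R).
  have -> : (2^-1 : R) = z / (2 * z) * 1^-1 by field; rewrite gt_eqF.
  have H1 : eta / (2 * z) @[eta --> z^'-] --> z / (2 * z).
    exact: (cvgMr_tmp (b := (2 * z)^-1) Heta).
  have H2 : ((z - eta) * Gamma (z - eta))^-1 @[eta --> z^'-] --> (1^-1 : R).
    by apply: cvgV; rewrite ?oner_neq0.
  exact: (cvgM H1 H2).
have Hlim := cvgM HC HI.
rewrite (_ : 2^-1 * (2 * a) = a) in Hlim; last by field.
apply: cvg_trans (Hlim _).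
(* Cancelling s = z - eta requires eta < z, which holds near z on the left. *)
apply: near_eq_cvg; near=> eta => /=.
have ez : eta < z by near: eta; exact: nbhs_left_lt.
rewrite subKr !invfM; move: (Gamma _)^-1 (Rintegral _ _ _) => G I; field.
by rewrite subr_eq0 !gt_eqF.
Unshelve. all: by end_near. Qed.

(** Serves both parts of the theorem: z = 1 gives the Marchaud factor itself, z = zeta its product
    with the Gamma quotient of the second part. *)
Lemma cvg_normalized_marchaud (Omega : set R) (beta K t z : R) (g : R -> R[i])
    (l : R[i]) :
  lebesgue_measurable Omega -> 1 < beta -> complement_thin beta Omega t ->
  lebesgue_measurable_cfun g ->
  (forall x, `|Re (g x)| <= K) -> (forall x, `|Im (g x)| <= K) -> 0 < z ->
  is_whitney_zeta_derive z Omega g t l ->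
  (eta / (2 * z * Gamma (z - eta)))%:C * marchaud_integral eta Omega g t
    @[eta --> z^'-] --> l.
Proof.
move=> mO beta1 thin [mRe mIm] ReK ImK z0 gl.
have bound (p : R -> R) : (forall x, `|p x| <= K) ->
    forall x, `|p (t + x) - p t| <= K + K.
  by move=> pK x; rewrite (le_trans (ler_normB _ _))// lerD.
have meas (p : R -> R) : lebesgue_measurable_fun p ->
    lebesgue_measurable_fun (fun x => p (t + x) - p t).
  move=> mp; apply: measurable_funB => //.
  exact: (lebesgue_measurable_fun_addr t p mp).
apply: cvg_complex.
- under eq_fun do rewrite Re_Cmul.
  rewrite /marchaud_integral/=.
  under eq_fun do under eq_Rintegral do rewrite Re_mulC Re_divC raddfB/=.
  apply: (cvg_normalized_kernel _ _ _ _ _ _ _ mO beta1 thin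
    (meas _ mRe) (bound _ ReK) z0).
  by move/cvg_complex_Re : gl; under eq_fun do rewrite Re_divC raddfB/=.
- under eq_fun do rewrite Im_Cmul.
  rewrite /marchaud_integral/=.
  under eq_fun do under eq_Rintegral do rewrite Im_mulC Im_divC raddfB/=.
  apply: (cvg_normalized_kernel _ _ _ _ _ _ _ mO beta1 thin
    (meas _ mIm) (bound _ ImK) z0).
  by move/cvg_complex_Im : gl; under eq_fun do rewrite Im_divC raddfB/=.
Qed.

(** Since sgn(delta) |delta| = delta, the first part is the case z = 1 of the common limit. *)
Lemma whitney_derive_zeta1 (Omega : set R) (g : R -> R[i]) (t : R) (l : R[i]) :
  is_whitney_derive Omega g t l -> is_whitney_zeta_derive 1 Omega g t l.
Proof.
rewrite /is_whitney_zeta_derive.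
by under eq_fun do rewrite powRr1// -numEsg.
Qed.

Lemma Gamma_gt0 (s : R) : 0 < s < 1 -> 0 < Gamma s.
Proof.
move=> /andP[s0 s1]; have /andP[+ _] : 1 - s <= s * Gamma s <= 1 + s.
  by apply: Gamma_bounds; rewrite s0 ltW.
rewrite -(pmulr_rgt0 _ s0); apply: lt_le_trans.
by rewrite subr_gt0.
Qed.

End whitney.

Theorem propositionF (R : realType) (Omega : set R)
    (mOmega : lebesgue_measurable Omega)
    (thin : exists2 beta : R, 1 < beta &
              forall x, Omega x -> complement_thin beta Omega x) :
  (forall (g : R -> R[i]) (t : R) (g't : R[i]),
     [bounded g x | x in setT] -> lebesgue_measurable_cfun g ->
     Omega t -> is_whitney_derive Omega g t g't ->
     whitney_marchaud eta Omega g t @[eta --> 1^'-] --> g't)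
  /\
  (forall (zeta : R) (g : R -> R) (t : R) (gzt : R[i]),
     0 < zeta < 1 ->
     [bounded g x | x in setT] -> lebesgue_measurable_fun g ->
     Omega t -> is_whitney_zeta_derive zeta Omega (fun x => (g x)%:C) t gzt ->
     (Gamma (1 - eta) / (zeta * Gamma (zeta - eta)))%:C *
       whitney_marchaud eta Omega (fun x => (g x)%:C) t
       @[eta --> zeta^'-] --> gzt).
Proof.
have [beta beta1 thinb] := thin; split.
  move=> g t l [M [Mreal gM]] mg Ot /whitney_derive_zeta1 gl.
  (* Boundedness supplies every constant above [M] as a bound. Here [M] lies in [R[i]], whose order
     compares real parts, whence the real bound [Re (M + 1)] below. *)
  have gB x : `|g x| <= M + 1 by apply: gM => //; rewrite ltrDl ltr01.
  have ReK x : `|complex.Re (g x)| <= complex.Re (M + 1).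
    by have := le_trans (normc_ge_Re _) (gB x); rewrite lecE/= => /andP[].
  have ImK x : `|complex.Im (g x)| <= complex.Re (M + 1).
    by have := le_trans (normc_ge_Im _) (gB x); rewrite lecE/= => /andP[].
  have := cvg_normalized_marchaud _ _ _ _ _ _ _ mOmega beta1 (thinb t Ot) mg
    ReK ImK ltr01 gl.
  by under eq_fun do rewrite mulr1.
move=> z g t l /andP[z0 z1] [M [Mreal gM]] mg Ot gl.
have gB x : `|g x| <= M + 1 by apply: gM => //; rewrite ltrDl ltr01.
have mgC : lebesgue_measurable_cfun (fun x => (g x)%:C).
  by split => //; exact: measurable_cst.
have ImK x : `|complex.Im (g x)%:C| <= M + 1.
  by rewrite /= normr0 (le_trans _ (gB x)).
have := cvg_normalized_marchaud _ _ _ _ _ _ _ mOmega beta1 (thinb t Ot) mgC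
  gB ImK z0 gl.
move=> Hlim; apply: cvg_trans Hlim; apply: near_eq_cvg; near=> eta.
rewrite /whitney_marchaud mulrA -rmorphM/=; congr (_%:C * _).
(* With 0 < eta < z < 1 both Gamma arguments lie in ]0, 1[, so [Gamma (1 - eta)] can be cancelled
   between the two factors. *)
have eta0 : 0 < eta by near: eta; exact: nbhs_left_gt.
have etaz : eta < z by near: eta; exact: nbhs_left_lt.
have G0 : Gamma (1 - eta) != 0 by rewrite gt_eqF// Gamma_gt0//; lra.
have Gz0 : Gamma (z - eta) != 0 by rewrite gt_eqF// Gamma_gt0//; lra.
by field; rewrite G0 Gz0 gt_eqF.
Unshelve. all: by end_near. Qed.
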